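(* Let $L:\mathbb{R}^n\times\mathbb{R}^m\to\mathbb{R}\cup\{+\infty\}$ be of the form $L(x,y)=f(x)+Q(x,y)+g(y)$, where $f:\mathbb{R}^n\to\mathbb{R}\cup\{+\infty\}$ and $g:\mathbb{R}^m\to\mathbb{R}\cup\{+\infty\}$ are proper lower semicontinuous functions, $Q:\mathbb{R}^n\times\mathbb{R}^m\to\mathbb{R}$ is a $C^1$ function, and $\nabla Q$ is Lipschitz continuous on bounded subsets of $\mathbb{R}^n\times\mathbb{R}^m$. Let $(x_0,y_0)\in\mathbb{R}^n\times\mathbb{R}^m$. Assume that $\inf_{\mathbb{R}^n\times\mathbb{R}^m}L>-\infty$, that the function $L(\cdot,y_0)$ is proper, and that for some $0<r_-<r_+$ the stepsizes $\lambda_k,\mu_k$ belong to $(r_-,r_+)$ for all $k\ge 0$. Let $(x_k,y_k)_{k\ge 0}$ be a sequence starting from $(x_0,y_0)$ such that for all $k\ge 0$ $$x_{k+1}\in\operatorname{argmin}\Big\{L(u,y_k)+\tfrac{1}{2\lambda_k}\|u-x_k\|^2:u\in\mathbb{R}^n\Big\},\qquad y_{k+1}\in\operatorname{argmin}\Big\{L(x_{k+1},v)+\tfrac{1}{2\mu_k}\|v-y_k\|^2:v\in\mathbb{R}^m\Big\}.$$ Assume further that $(x_k,y_k)$ converges to $(x_\infty,y_\infty)$ and that $L$ has the Kurdyka-Łojasiewicz property at $(x_\infty,y_\infty)$ with $\varphi(s)=a\,s^{1-\theta}$, where $\theta\in[0,1)$ and $a>0$. Then: (i) If $\theta=0$,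 the sequence $(x_k,y_k)_{k\in\mathbb{N}}$ converges in a finite number of steps. (ii) If $\theta\in(0,\tfrac12]$, there exist $c>0$ and $\tau\in[0,1)$ such that $\|(x_k,y_k)-(x_\infty,y_\infty)\|\le c\,\tau^k$ for all $k$. (iii) If $\theta\in(\tfrac12,1)$, there exists $c>0$ such that $\|(x_k,y_k)-(x_\infty,y_\infty)\|\le c\,k^{-\frac{1-\theta}{2\theta-1}}$ for all $k\ge1$.
   Context: $\|\cdot\|$ is the Euclidean norm. For a proper lower semicontinuous $h:\mathbb{R}^N\to\mathbb{R}\cup\{+\infty\}$, $\operatorname{dom}h=\{x:h(x)<+\infty\}$. For $x\in\operatorname{dom}h$ the Fréchet subdifferential $\hat\partial h(x)$ is the set of $x^*$ with $\liminf_{y\to x,\,y\ne x}\frac{1}{\|x-y\|}[h(y)-h(x)-\langle x^*,y-x\rangle]\ge 0$. The (limiting) subdifferential of $h$ at $x\in\operatorname{dom}h$ is $\partial h(x)=\{x^*:\exists\,x_j\to x,\ h(x_j)\to h(x),\ x_j^*\in\hat\partial h(x_j),\ x_j^*\to x^*\}$, and both are empty for $x\notin\operatorname{dom}h$; $\operatorname{dom}\partial h=\{x:\partial h(x)\neq\emptyset\}$. $\operatorname{dist}(x,K)=\inf\{\|x-z\|:z\in K\}$, equal to $+\infty$ if $K=\emptyset$. The function $h$ has the Kurdyka-Łojasiewicz property at $\bar x\in\operatorname{dom}\partial h$ with the function $\varphi$ if there exist $\eta\in(0,+\infty]$ and a neighborhood $U$ of $\bar x$ such that $\varphi:[0,\eta)\to\mathbb{R}_+$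 is continuous and concave, $\varphi(0)=0$, $\varphi$ is $C^1$ on $(0,\eta)$, $\varphi'(s)>0$ for all $s\in(0,\eta)$, and for all $x\in U$ with $h(\bar x)<h(x)<h(\bar x)+\eta$ one has $\varphi'(h(x)-h(\bar x))\,\operatorname{dist}(0,\partial h(x))\ge 1$. ''Converges in a finite number of steps'' means that $(x_k,y_k)=(x_\infty,y_\infty)$ for all sufficiently large $k$. *)

(* Defs.v *)
From HB Require Import structures.
From mathcomp Require Import all_boot all_order all_algebra.
From mathcomp Require Import all_classical all_reals all_analysis.
Import Order.TTheory GRing.Theory Num.Theory.
Import numFieldNormedType.Exports.

Set Implicit Arguments.
Unset Strict Implicit.
Unset Printing Implicit Defensive.

Local Open Scope classical_set_scope.
Local Open Scope ring_scope.

(* Points of R^N are row vectors. The norm `|x| that the library puts on them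
   is the sup norm, so the Euclidean norm is defined separately; the library's
   topology and bounded sets on 'rV[R]_N are the Euclidean ones. A point (x, y)
   of R^n * R^m is row_mx x y : 'rV[R]_(n + m), whose Euclidean norm is the
   Euclidean norm of the product. *)
Definition dot (R : realType) (N : nat) (u v : 'rV[R]_N) : R :=
  \sum_(i < N) u 0 i * v 0 i.

Definition enorm (R : realType) (N : nat) (u : 'rV[R]_N) : R :=
  Num.sqrt (dot u u).

(* Functions with values in R \cup {+oo} are \bar R-valued functions that avoid
   -oo; that restriction is the first clause of properness. *)
Definition proper_efun (R : realType) (T : Type) (h : T -> \bar R) : Prop :=
  (forall x, (-oo < h x)%E) /\ (exists x, (h x < +oo)%E).

Definition gradient (R : realType) (N : nat) (q : 'rV[R]_N -> R)
    (z : 'rV[R]_N) : 'rV[R]_N :=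
  \row_(i < N) 'D_(delta_mx 0 i) q z.

Definition C1 (R : realType) (N : nat) (q : 'rV[R]_N -> R) : Prop :=
  (forall z, differentiable q z) /\ continuous (gradient q).

Definition lipschitz_on_bounded_sets (R : realType) (N M : nat)
    (F : 'rV[R]_N -> 'rV[R]_M) : Prop :=
  forall B : set 'rV[R]_N, bounded_set B ->
    exists K : R, forall z z', B z -> B z' ->
      enorm (F z - F z') <= K * enorm (z - z').

Definition argmin (R : realType) (T : Type) (F : T -> \bar R) : set T :=
  [set u | forall v, (F u <= F v)%E].

Definition frechet_subdiff (R : realType) (N : nat) (h : 'rV[R]_N -> \bar R)
    (x : 'rV[R]_N) : set 'rV[R]_N :=
  [set xs | (h x < +oo)%E /\
    (0 <= limf_einf (fun y : 'rV[R]_N =>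
            ((enorm (x - y))^-1)%:E * (h y - h x - (dot xs (y - x))%:E)) x^')%E].

Definition limiting_subdiff (R : realType) (N : nat) (h : 'rV[R]_N -> \bar R)
    (x : 'rV[R]_N) : set 'rV[R]_N :=
  [set xs | (h x < +oo)%E /\
    exists (xj xsj : nat -> 'rV[R]_N),
      [/\ xj j @[j --> \oo] --> x,
          h (xj j) @[j --> \oo] --> h x,
          forall j, frechet_subdiff h (xj j) (xsj j)
        & xsj j @[j --> \oo] --> xs]].

Definition dist_to_set (R : realType) (N : nat) (x : 'rV[R]_N) (K : set 'rV[R]_N) :
    \bar R :=
  ereal_inf [set (enorm (x - z))%:E | z in K].

(* phi is a total function on R, of which only the values on [0, eta) matter. *)
Definition desingularizing (R : realType) (eta : \bar R) (phi : R -> R) : Prop :=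
  let I0 := [set s : R | 0 <= s /\ (s%:E < eta)%E] in
  let I := [set s : R | 0 < s /\ (s%:E < eta)%E] in
  [/\ forall s, I0 s -> 0 <= phi s,
      {within I0, continuous phi},
      convex_function (E := R^o) I0 (fun s => - phi s),
      phi 0 = 0 &
      [/\ forall s, I s -> derivable phi s 1,
          {within I, continuous (derive1 phi)}
        & forall s, I s -> 0 < derive1 phi s]].

Definition KL_property (R : realType) (N : nat) (h : 'rV[R]_N -> \bar R)
    (xbar : 'rV[R]_N) (phi : R -> R) : Prop :=
  limiting_subdiff h xbar !=set0 /\
  exists (eta : \bar R) (U : set 'rV[R]_N),
    [/\ (0 < eta)%E, nbhs xbar U, desingularizing eta phi &
        forall x, U x -> (h xbar < h x)%E -> (h x < h xbar + eta)%E ->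
          (1 <= (derive1 phi (fine (h x - h xbar)%E))%:E
                * dist_to_set 0 (limiting_subdiff h x))%E].

(* Main.v *)
Require Import Defs.
From HB Require Import structures.
From mathcomp Require Import all_boot all_order all_algebra.
From mathcomp Require Import all_classical all_reals all_analysis.
From mathcomp Require Import ring lra zify.
Import Order.TTheory GRing.Theory Num.Theory.
Import numFieldNormedType.Exports.
Local Open Scope classical_set_scope.
Local Open Scope ring_scope.
Set Implicit Arguments.
Unset Strict Implicit.
Unset Printing Implicit Defensive.

(** Write [z k = row_mx (x k) (y k)] for the iterates, [r k] for the gap between
    the value of [L] at [z k] and its value at the limit, and [d k] for the
    Euclidean length of the step from [z k] to [z k.+1]. Everything follows from
    three facts about these sequences.

    - Each block minimization is compared with the previous value of the block,
      so [r k.+1 + alpha * d k ^ 2 <= r k] ([alternating_decrease]).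
    - The optimality conditions of the two block problems provide a Frechet
      subgradient of [L] at [z k.+1] whose norm is at most a multiple of [d k],
      because the gradient of the coupling is Lipschitz near the limit
      ([alternating_subgradient]).
    - [r k] tends to [0] ([alternating_value_cvg]): the limit point is itself
      a competitor in the block problems, which forces the values of [f] and [g]
      along the iterates to converge to their values at the limit, although
      these functions are only lower semicontinuous.

    Since [r] is nonincreasing it is therefore nonnegative, and the iterates
    enter the region where the Kurdyka-Lojasiewicz inequality applies. With
    [phi s = a * s ^ (1 - theta)] it becomes [r k.+1 ^ theta <= B * d k]
    whenever [r k.+1 > 0] ([KL_power_slope], [alternating_lojasiewicz_descent]).
    From here on only the sequences matter ([lojasiewicz_descent]).

    If [theta = 0], a positive gap keeps the steps away from [0], which the
    convergence of [z] forbids in the long run ([descent_finite]).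

    If [0 < theta < 1], concavity of the power [1 - theta] gives
    [2 * d k.+1 <= d k + C * (r k.+1 ^ (1 - theta) - r k.+2 ^ (1 - theta))]
    ([descent_step]). Summation telescopes and bounds the distance from [z k.+1]
    to the limit by [d k + C * r k.+1 ^ (1 - theta)] ([descent_distance]), hence
    by a multiple of [r k ^ min(1/2, 1 - theta)], because [d k] is at most a
    multiple of the square root of [r k]. It remains to see how fast [r] decays.
    Eliminating [d k] between the decrease of the values and the Lojasiewicz
    inequality gives [c * r k.+1 ^ (2 * theta) <= r k - r k.+1]
    ([gap_recursion]). For [theta <= 1/2] the exponent on the left is at most
    [1] and the decay is geometric; for [theta > 1/2] it is [1 + nu] with
    [nu = 2 * theta - 1], and [r k ^ nu] is [O(1 / k)] ([power_decay]), which
    gives the exponent [(1 - theta) / nu] of the last claim. *)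

(** * Euclidean geometry of row vectors *)

Lemma dotC (R : realType) N (u v : 'rV[R]_N) : dot u v = dot v u.
Proof. by apply: eq_bigr => i _; rewrite mulrC. Qed.

Lemma dotDl (R : realType) N (u v w : 'rV[R]_N) :
  dot (u + v) w = dot u w + dot v w.
Proof. by rewrite -big_split; apply: eq_bigr => i _; rewrite mxE mulrDl. Qed.

Lemma dotZl (R : realType) N (c : R) (u w : 'rV[R]_N) :
  dot (c *: u) w = c * dot u w.
Proof. by rewrite mulr_sumr; apply: eq_bigr => i _; rewrite mxE mulrA. Qed.

Lemma dotNl (R : realType) N (u w : 'rV[R]_N) : dot (- u) w = - dot u w.
Proof. by rewrite -scaleN1r dotZl mulN1r. Qed.

Lemma dot0r (R : realType) N (u : 'rV[R]_N) : dot u 0 = 0.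
Proof. by rewrite dotC -(scale0r 0) dotZl mul0r. Qed.

Lemma dot_row_mx (R : realType) n m (u u' : 'rV[R]_n) (v v' : 'rV[R]_m) :
  dot (row_mx u v) (row_mx u' v') = dot u u' + dot v v'.
Proof.
rewrite /dot big_split_ord /=; congr (_ + _); apply: eq_bigr => i _.
  by rewrite !row_mxEl.
by rewrite !row_mxEr.
Qed.

Lemma dot_ge0 (R : realType) N (u : 'rV[R]_N) : 0 <= dot u u.
Proof. by apply: sumr_ge0 => i _; exact: sqr_ge0. Qed.

Lemma enorm_ge0 (R : realType) N (u : 'rV[R]_N) : 0 <= enorm u.
Proof. exact: sqrtr_ge0. Qed.

Lemma sqr_enorm (R : realType) N (u : 'rV[R]_N) : enorm u ^+ 2 = dot u u.
Proof. by rewrite sqr_sqrtr // dot_ge0. Qed.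

Lemma enorm0 (R : realType) N : enorm (0 : 'rV[R]_N) = 0.
Proof. by rewrite /enorm -(scale0r 0) dotZl mul0r sqrtr0. Qed.

Lemma enormZ (R : realType) N (c : R) (u : 'rV[R]_N) :
  enorm (c *: u) = `|c| * enorm u.
Proof.
by rewrite /enorm dotZl dotC dotZl mulrA -expr2 sqrtrM ?sqr_ge0// sqrtr_sqr.
Qed.

Lemma enormN (R : realType) N (u : 'rV[R]_N) : enorm (- u) = enorm u.
Proof. by rewrite -scaleN1r enormZ normrN1 mul1r. Qed.

Lemma enormBC (R : realType) N (u v : 'rV[R]_N) : enorm (u - v) = enorm (v - u).
Proof. by rewrite -enormN opprB. Qed.

Lemma sqr_enormD (R : realType) N (u v : 'rV[R]_N) :
  enorm (u + v) ^+ 2 = enorm u ^+ 2 + 2 * dot u v + enorm v ^+ 2.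
Proof.
by rewrite !sqr_enorm dotDl ![dot _ (u + v)]dotC !dotDl [dot v u]dotC; ring.
Qed.

Lemma enorm_row_mx (R : realType) n m (u : 'rV[R]_n) (v : 'rV[R]_m) :
  enorm (row_mx u v) ^+ 2 = enorm u ^+ 2 + enorm v ^+ 2.
Proof. by rewrite !sqr_enorm dot_row_mx. Qed.

Lemma enorm_rowl (R : realType) n m (u : 'rV[R]_n) (v : 'rV[R]_m) :
  enorm u <= enorm (row_mx u v).
Proof.
rewrite -(@ler_pXn2r _ 2)// ?nnegrE ?enorm_ge0// enorm_row_mx.
by rewrite lerDl sqr_ge0.
Qed.

Lemma enorm_rowr (R : realType) n m (u : 'rV[R]_n) (v : 'rV[R]_m) :
  enorm v <= enorm (row_mx u v).
Proof.
rewrite -(@ler_pXn2r _ 2)// ?nnegrE ?enorm_ge0// enorm_row_mx.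
by rewrite lerDr sqr_ge0.
Qed.

Lemma enorm_row_le (R : realType) n m (u : 'rV[R]_n) (v : 'rV[R]_m) :
  enorm (row_mx u v) <= enorm u + enorm v.
Proof.
have [u0 v0] := (enorm_ge0 u, enorm_ge0 v).
rewrite -(@ler_pXn2r _ 2)// ?nnegrE ?enorm_ge0// ?addr_ge0// enorm_row_mx.
by rewrite sqrrD addrAC lerDl mulrn_wge0// mulr_ge0.
Qed.

Lemma enorm_row0r (R : realType) n m (u : 'rV[R]_n) :
  enorm (row_mx u (0 : 'rV[R]_m)) = enorm u.
Proof.
apply: le_anti; rewrite enorm_rowl andbT.
by have := enorm_row_le u (0 : 'rV[R]_m); rewrite enorm0 addr0.
Qed.

Lemma enorm_row0l (R : realType) n m (v : 'rV[R]_m) :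
  enorm (row_mx (0 : 'rV[R]_n) v) = enorm v.
Proof.
apply: le_anti; rewrite enorm_rowr andbT.
by have := enorm_row_le (0 : 'rV[R]_n) v; rewrite enorm0 add0r.
Qed.

Lemma row_mxBl (R : realType) n m (u u' : 'rV[R]_n) (v : 'rV[R]_m) :
  row_mx u v - row_mx u' v = row_mx (u - u') 0.
Proof. by rewrite opp_row_mx add_row_mx subrr. Qed.

Lemma row_mxBr (R : realType) n m (u : 'rV[R]_n) (v v' : 'rV[R]_m) :
  row_mx u v - row_mx u v' = row_mx 0 (v - v').
Proof. by rewrite opp_row_mx add_row_mx subrr. Qed.

Lemma enorm_lsubmx (R : realType) n m (w : 'rV[R]_(n + m)) :
  enorm (lsubmx w) <= enorm w.
Proof. by rewrite -{2}[w]hsubmxK enorm_rowl. Qed.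

(** Cauchy-Schwarz: expand the square of the norm of
    [enorm v *: u - enorm u *: v]. *)
Lemma dot_le_enorm (R : realType) N (u v : 'rV[R]_N) :
  dot u v <= enorm u * enorm v.
Proof.
have [u0 v0] := (enorm_ge0 u, enorm_ge0 v).
have sq0 (w : 'rV[R]_N) : enorm w = 0 -> forall w', dot w w' = 0.
  move=> w0 w'; apply: big1 => i _; suff -> : w 0 i = 0 by rewrite mul0r.
  have /eqP : dot w w = 0 by rewrite -sqr_enorm w0 expr0n.
  rewrite psumr_eq0 => [/allP /(_ i)|j _]; last exact: sqr_ge0.
  by rewrite mem_index_enum mulf_eq0 orbb => /(_ isT) /eqP.
have [/eqP /sq0 ->|un0] := boolP (enorm u == 0); first by rewrite mulr_ge0.
have [/eqP /sq0 vE|vn0] := boolP (enorm v == 0).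
  by rewrite dotC vE mulr_ge0.
have p : 0 < enorm u * enorm v by rewrite mulr_gt0// lt0r ?un0 ?vn0.
have := sqr_ge0 (enorm (enorm v *: u - enorm u *: v)).
rewrite sqr_enormD enormN !enormZ !ger0_norm// dotZl dotC dotNl dotZl.
rewrite [dot v u]dotC.
set a := enorm u in p *; set b := enorm v in p *; set d := dot u v => H.
have : 0 <= 2 * (a * b) * (a * b - d) by lra.
by rewrite pmulr_rge0 ?subr_ge0 // mulr_gt0.
Qed.

Lemma enormD (R : realType) N (u v : 'rV[R]_N) :
  enorm (u + v) <= enorm u + enorm v.
Proof.
have [u0 v0] := (enorm_ge0 u, enorm_ge0 v).
rewrite -(@ler_pXn2r _ 2)// ?nnegrE ?enorm_ge0// ?addr_ge0//.
rewrite sqr_enormD sqrrD; have := dot_le_enorm u v; lra.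
Qed.

Lemma enormB_triangle (R : realType) N (u v w : 'rV[R]_N) :
  enorm (u - w) <= enorm (u - v) + enorm (v - w).
Proof. by rewrite -[u in X in X <= _](subrK v) -addrA enormD. Qed.

Lemma norm_le_enorm (R : realType) N (u : 'rV[R]_N) : `|u| <= enorm u.
Proof.
rewrite [X in X <= _]mx_normrE; apply/bigmax_leP; split=> [|[i j] _]/=.
  exact: enorm_ge0.
rewrite ord1 -(@ler_pXn2r _ 2)// ?nnegrE ?enorm_ge0// sqr_enorm.
rewrite real_normK ?num_real// /dot (bigD1 j)//= -expr2 lerDl.
by apply: sumr_ge0 => k _; exact: sqr_ge0.
Qed.

Lemma enorm_eq0 (R : realType) N (u : 'rV[R]_N) : enorm u <= 0 -> u = 0.
Proof.
move=> u0; apply/normr0_eq0/le_anti.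
by rewrite normr_ge0 (le_trans (norm_le_enorm u)).
Qed.

Lemma enorm_le_norm (R : realType) N (u : 'rV[R]_N) :
  enorm u <= N.+1%:R * `|u|.
Proof.
rewrite -(@ler_pXn2r _ 2)// ?nnegrE ?enorm_ge0// ?mulr_ge0// sqr_enorm.
have lei i : u 0 i * u 0 i <= `|u| ^+ 2.
  rewrite -expr2 -[X in X <= _]real_normK ?num_real//.
  rewrite ler_pXn2r// ?nnegrE// [X in _ <= X]mx_normrE.
  exact: (le_bigmax _ (fun ij => `|u ij.1 ij.2|) (0, i)).
rewrite exprMn; apply: (@le_trans _ _ (\sum_(i < N) `|u| ^+ 2)).
  exact: ler_sum.
rewrite sumr_const card_ord -[X in X <= _]mulr_natl ler_wpM2r ?sqr_ge0//.
by rewrite -natrX ler_nat; apply: leq_trans (leqnSn _) _; exact: leq_pmulr.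
Qed.

(** Neighborhoods of row vectors are defined by the sup norm; this lemma and
    [cvg_enormP] let every local argument be run with Euclidean balls. *)
Lemma near_enormP (R : realType) N (z : 'rV[R]_N) (P : set 'rV[R]_N) :
  (\forall w \near z, P w) <->
  exists2 e : R, 0 < e & forall w, enorm (w - z) < e -> P w.
Proof.
split=> [/nbhs_ballP[e /= e0 eP]|[e e0 eP]].
  exists e => // w we; apply: eP; rewrite -ball_normE /= distrC.
  exact: le_lt_trans (norm_le_enorm _) we.
apply/nbhs_ballP; exists (e / N.+1%:R) => /=; first by rewrite divr_gt0.
move=> w; rewrite -ball_normE /= ltr_pdivlMr// => we; apply: eP.
by rewrite enormBC (le_lt_trans (enorm_le_norm _))// mulrC.
Qed.

Lemma cvg_enormP (R : realType) N (z : nat -> 'rV[R]_N) (l : 'rV[R]_N) :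
  z k @[k --> \oo] --> l <->
  forall e : R, 0 < e -> \forall k \near \oo, enorm (z k - l) < e.
Proof.
split=> [zl e e0|zl A].
  have /zl : nbhs l [set w | enorm (w - l) < e] by apply/near_enormP; exists e.
  by apply.
case/near_enormP=> e e0 eA; have := zl _ e0; apply: filterS => k; exact: eA.
Qed.

Lemma cvg_enorm0 (R : realType) N (z : nat -> 'rV[R]_N) (l : 'rV[R]_N) :
  z k @[k --> \oo] --> l -> enorm (z k - l) @[k --> \oo] --> (0 : R).
Proof.
move=> /cvg_enormP H; apply/cvgrPdist_lt => e e0; apply: filterS (H e e0) => k.
by rewrite sub0r normrN ger0_norm ?enorm_ge0.
Qed.

Lemma cvg_row_mx (R : realType) n m (u : nat -> 'rV[R]_n) (v : nat -> 'rV[R]_m)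
    (u0 : 'rV[R]_n) (v0 : 'rV[R]_m) :
  u k @[k --> \oo] --> u0 -> v k @[k --> \oo] --> v0 ->
  row_mx (u k) (v k) @[k --> \oo] --> row_mx u0 v0.
Proof.
move=> /cvg_enormP Hu /cvg_enormP Hv; apply/cvg_enormP => e e0.
have e2 : 0 < e / 2 by rewrite divr_gt0.
apply: filterS2 (Hu _ e2) (Hv _ e2) => k h1 h2.
rewrite opp_row_mx add_row_mx.
by apply: le_lt_trans (enorm_row_le _ _) _; lra.
Qed.

Lemma cvg_lrow (R : realType) n m (u : nat -> 'rV[R]_n) (v : nat -> 'rV[R]_m)
    (u0 : 'rV[R]_n) (v0 : 'rV[R]_m) :
  row_mx (u k) (v k) @[k --> \oo] --> row_mx u0 v0 -> u k @[k --> \oo] --> u0.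
Proof.
move=> /cvg_enormP H; apply/cvg_enormP => e e0; apply: filterS (H e e0) => k.
by rewrite opp_row_mx add_row_mx; apply: le_lt_trans; exact: enorm_rowl.
Qed.

Lemma cvg_rrow (R : realType) n m (u : nat -> 'rV[R]_n) (v : nat -> 'rV[R]_m)
    (u0 : 'rV[R]_n) (v0 : 'rV[R]_m) :
  row_mx (u k) (v k) @[k --> \oo] --> row_mx u0 v0 -> v k @[k --> \oo] --> v0.
Proof.
move=> /cvg_enormP H; apply/cvg_enormP => e e0; apply: filterS (H e e0) => k.
by rewrite opp_row_mx add_row_mx; apply: le_lt_trans; exact: enorm_rowr.
Qed.

Lemma enorm_lt1_bounded (R : realType) N (z : 'rV[R]_N) :
  bounded_set [set w : 'rV[R]_N | enorm (w - z) < 1].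
Proof.
exists (`|z| + 1); split; first by rewrite num_real.
move=> M zM w /= wz; apply: le_trans (ltW zM).
rewrite -[w](subrK z) addrC; apply: le_trans (ler_normD _ _) _.
by rewrite lerD2l (le_trans (norm_le_enorm _))// ltW.
Qed.

(** * Real inequalities and rates of decay *)

(** Young's inequality for the product [w ^ p * 1], with the conjugate exponents
    [p^-1] and [(1 - p)^-1]. *)
Lemma powR_le_tangent (R : realType) (w p : R) :
  0 <= w -> 0 < p < 1 -> w `^ p <= 1 + p * (w - 1).
Proof.
move=> w0 /andP[p0 p1]; have q0 : 0 < 1 - p by rewrite subr_gt0.
have := @conjugate_powR _ (w `^ p) 1 p^-1 (1 - p)^-1 (powR_ge0 _ _) ler01.
rewrite !invr_gt0 !invrK mulr1 powR1 -powRrM divff ?gt_eqF// powRr1// => H.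
by apply: (le_trans (H p0 q0 _)); lra.
Qed.

(** The graph of the power [p] lies below its tangent at [s]; both sides have
    been multiplied by [s ^ (1 - p)], which clears the derivative. *)
Lemma powR_concave (R : realType) (s t p : R) :
  0 < s -> 0 <= t -> 0 < p < 1 ->
  p * (s - t) <= s `^ (1 - p) * (s `^ p - t `^ p).
Proof.
move=> s0 t0 p01; have w0 : 0 <= t / s by rewrite divr_ge0// ltW.
have tE : t = s * (t / s) by rewrite mulrC divfK// gt_eqF.
have sE : s `^ (1 - p) * s `^ p = s.
  by rewrite -powRD ?subrK ?powRr1 ?(ltW s0)// (gt_eqF s0) implybT.
rewrite [in X in _ <= X]tE powRM// ?(ltW s0)// -[X in _ <= _ * (X - _)]mulr1.
rewrite -mulrBr mulrA sE; have := powR_le_tangent w0 p01 => H.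
have -> : p * (s - t) = s * (p * (1 - t / s)).
  by field; rewrite gt_eqF.
by rewrite ler_pM2l//; lra.
Qed.

Lemma ge1_powR_antimono (R : realType) (r x y : R) :
  0 <= r <= 1 -> 0 < x -> x <= y -> r `^ y <= r `^ x.
Proof.
move=> /andP[r0 r1] x0 xy; have [->|rn0] := eqVneq r 0.
  by rewrite !powR0 ?gt_eqF// (lt_le_trans x0).
by apply: ger_powR => //; rewrite lt0r rn0 r0.
Qed.

Lemma sqr_powR (R : realType) (r t : R) : (r `^ t) ^+ 2 = r `^ (2 * t).
Proof. by rewrite -powR_mulrn ?powR_ge0// -powRrM mulrC. Qed.

Lemma geometric_decay (R : realType) (r : nat -> R) (c : R) :
  0 < c -> (forall k, c * r k.+1 <= r k - r k.+1) ->
  forall k, r k <= r 0%N * (1 + c)^-1 ^+ k.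
Proof.
move=> c0 H; elim=> [|k IH]; first by rewrite expr0 mulr1.
rewrite exprSr mulrA ler_pdivlMr; last by lra.
by apply: le_trans IH; have := H k; lra.
Qed.

(** The discrete analogue of the differential inequality
    [r' <= - c r^(1 + nu)]: the quantity [r^(- nu)] grows at least linearly.
    It is stated without the negative power, so that [r] may vanish. *)
Lemma power_decay (R : realType) (r : nat -> R) (c nu : R) :
  0 < c -> 0 < nu < 1 -> (forall k, 0 <= r k <= 1) ->
  (forall k, r k.+1 <= r k) ->
  (forall k, 0 < r k.+1 -> c * r k.+1 `^ (1 + nu) <= r k - r k.+1) ->
  exists2 e : R, 0 < e & forall k, e * k%:R * r k `^ nu <= 1.
Proof.
move=> c0 nu01 r01 rdec H; have /andP[nu0 nu1] := nu01.
have c1 : 0 < 1 + c by lra.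
(* with [p = r k.+1 ^ nu <= 1], the hypothesis reads
   [r k.+1 * (1 + c * p) <= r k]; the tangent inequality at [r k.+1 / r k] gives
   the factor [nu] of the witness, and [1 + c * p <= 1 + c] its denominator *)
exists (nu * c / (1 + c)); first by rewrite divr_gt0// mulr_gt0.
set e := _ / _; have e0 : 0 < e by rewrite divr_gt0// mulr_gt0.
elim=> [|k IH]; first by rewrite mulr0 mul0r.
have /andP[s0 s1] := r01 k.+1; have /andP[t0 t1] := r01 k.
have [->|sn0] := eqVneq (r k.+1) 0; first by rewrite powR0 ?gt_eqF// mulr0.
have sp : 0 < r k.+1 by rewrite lt0r sn0.
have tp : 0 < r k by apply: lt_le_trans sp _.
have Hk := H k sp; move: IH; set p := r k.+1 `^ nu; set q := r k `^ nu => IH.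
have p0 : 0 < p by exact: powR_gt0.
have p1 : p <= 1.
  rewrite -(powRr0 (r k.+1)) ger_powR// ?sp//; exact: ltW.
have q0 : 0 < q by exact: powR_gt0.
have sE : r k.+1 `^ (1 + nu) = r k.+1 * p.
  by rewrite powRD ?powRr1// sn0 implybT.
have pq : p <= q * (1 - e * p).
  have pE : p = q * (r k.+1 / r k) `^ nu.
    by rewrite -powRM ?divr_ge0// mulrC divfK// gt_eqF.
  rewrite [X in X <= _]pE ler_pM2l//.
  apply: le_trans (powR_le_tangent (divr_ge0 s0 t0) nu01) _.
  rewrite lerD2l.
  have -> : - (e * p) = nu * - (c * p / (1 + c)).
    by rewrite /e; field; rewrite gt_eqF.
  rewrite ler_pM2l// lerBlDr ler_pdivrMr//.
  have : r k.+1 * (1 + c * p) <= r k by move: Hk; rewrite sE; lra.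
  move=> Hk'.
  have v0 : 0 <= 1 - c * p / (1 + c).
    by rewrite subr_ge0 ler_pdivrMr//; have := ler_wpM2l (ltW c0) p1; lra.
  rewrite [- _ + 1]addrC; apply: le_trans (ler_wpM2l v0 Hk').
  rewrite mulrCA ler_peMr//.
  have -> : (1 - c * p / (1 + c)) * (1 + c * p) =
    1 + (c * p) * (c * (1 - p)) / (1 + c) by field; rewrite gt_eqF.
  by rewrite lerDl divr_ge0 ?(ltW c1)// !mulr_ge0 ?subr_ge0// ltW.
have m0 : 0 <= e * k%:R by rewrite mulr_ge0// ltW.
have ep : 0 <= 1 - e * p.
  by rewrite -(pmulr_rge0 _ q0); apply: le_trans pq; exact: ltW.
have h1 := ler_wpM2l m0 pq; have h2 := ler_wpM2r ep IH.
by rewrite -natr1; lra.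
Qed.

(** Rates only concern the tail: a bound valid from some rank on holds
    everywhere after enlarging the constant. *)
Lemma eventual_bound (R : realType) (e b : nat -> R) (c : R) (k0 K : nat) :
  (forall k, 0 <= e k) -> (forall k, 0 <= b k) ->
  (forall k, (k0 <= k)%N -> 0 < b k) ->
  (forall k, (K <= k)%N -> e k <= c * b k) ->
  exists2 c' : R, 0 < c' & forall k, (k0 <= k)%N -> e k <= c' * b k.
Proof.
move=> e0 b0 bp H; set S := \sum_(j < K) e j / b j.
have S0 : 0 <= S by apply: sumr_ge0 => j _; rewrite divr_ge0.
exists (`|c| + 1 + S) => [|k k0k].
  by rewrite ltr_wpDr// ltr_wpDl.
have [Kk|kK] := leqP K k.
  apply: le_trans (H k Kk) _; apply: ler_wpM2r => //.
  by apply: le_trans (ler_norm c) _; rewrite -addrA lerDl addr_ge0.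
rewrite -ler_pdivrMr ?bp//; apply: (@le_trans _ _ S); last first.
  by rewrite lerDr addr_ge0.
rewrite /S (bigD1 (Ordinal kK))//= lerDl.
by apply: sumr_ge0 => j _; rewrite divr_ge0.
Qed.

(** * Convergence rates of descent sequences under a Lojasiewicz inequality *)

(** What a descent method leaves behind once the geometry is forgotten: [r k]
    is the gap between the current value and the limit value, and [ld_grad] is
    the Lojasiewicz inequality in which the slope at the point [z k.+1] has been
    bounded by the length of the step that led to it. *)
Record lojasiewicz_descent (R : realType) (N : nat) (z : nat -> 'rV[R]_N)
    (l : 'rV[R]_N) (r : nat -> R) (alpha B theta : R) : Prop := {
  ld_alpha : 0 < alpha;
  ld_B : 0 < B;
  ld_cvg : z k @[k --> \oo] --> l;
  ld_range : forall k, 0 <= r k <= 1;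
  ld_decr : forall k, r k.+1 + alpha * enorm (z k.+1 - z k) ^+ 2 <= r k;
  ld_grad : forall k, 0 < r k.+1 ->
    r k.+1 `^ theta <= B * enorm (z k.+1 - z k)
}.

Section descent.
Context (R : realType) (N : nat) (z : nat -> 'rV[R]_N) (l : 'rV[R]_N).
Context (r : nat -> R) (alpha B theta : R).
Context (D : lojasiewicz_descent z l r alpha B theta).

Let d k := enorm (z k.+1 - z k).
Let a0 : 0 < alpha := ld_alpha D.
Let B0 : 0 < B := ld_B D.

Let r0 k : 0 <= r k. Proof. by case/andP: (ld_range D k). Qed.
Let d0 k : 0 <= d k. Proof. exact: enorm_ge0. Qed.

Lemma descent_nonincreasing k : r k.+1 <= r k.
Proof.
by apply: le_trans (ld_decr D k); rewrite lerDl mulr_ge0 ?sqr_ge0// ltW.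
Qed.

(** With exponent [0] the Lojasiewicz inequality keeps the steps away from [0]
    as long as the gap is positive, so the gap vanishes after finitely many
    steps; and a step that does not decrease the value is trivial. *)
Lemma descent_finite : theta = 0 -> exists K, forall k, (K <= k)%N -> z k = l.
Proof.
move=> theta0; have e0 : 0 < (2 * B)^-1 by rewrite invr_gt0 mulr_gt0.
have [K _ KP] := (cvg_enormP z l).1 (ld_cvg D) _ e0.
have rz k : (K <= k)%N -> r k.+1 = 0.
  move=> Kk; apply/eqP/negPn/negP => rn0.
  have rp : 0 < r k.+1 by rewrite lt0r rn0 r0.
  have := ld_grad D rp; rewrite theta0 powRr0 => H.
  have := enormB_triangle (z k.+1) l (z k); rewrite [enorm (l - _)]enormBC => T.
  have /= h1 := KP k Kk; have /= h2 := KP k.+1 (leqW Kk).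
  have : B * d k < B * (2 * (2 * B)^-1) by rewrite ltr_pM2l// /d; lra.
  have -> : B * (2 * (2 * B)^-1) = 1 by field; rewrite gt_eqF.
  by rewrite /d; lra.
have zc j : z (K.+1 + j)%N = z K.+1.
  elim: j => [|j IH]; first by rewrite addn0.
  rewrite addnS -[RHS]IH; apply/eqP; rewrite -subr_eq0; apply/eqP/enorm_eq0.
  have := ld_decr D (K.+1 + j)%N; rewrite -/(d _).
  rewrite !rz ?add0r; [|by rewrite leq_addr|by rewrite leqW// leq_addr].
  rewrite pmulr_rle0// => H; rewrite -/(d _) leNgt; apply/negP => dp.
  by move: H; rewrite leNgt exprn_gt0.
exists K.+1 => k Kk; rewrite -(subnKC Kk) zc.
apply/eqP; rewrite -subr_eq0; apply/eqP/enorm_eq0/ler_addgt0Pr => e ep.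
have [K' _ K'P] := (cvg_enormP z l).1 (ld_cvg D) _ ep.
have /= := K'P (K.+1 + K')%N (leq_addl _ _).
by rewrite zc add0r => /ltW.
Qed.

Lemma step_le_sqrt_gap k : d k <= (alpha^-1 * r k) `^ 2^-1.
Proof.
have ar0 : 0 <= alpha^-1 * r k by rewrite mulr_ge0// invr_ge0 ltW.
rewrite -(@ler_pXn2r _ 2)// ?nnegrE ?powR_ge0// sqr_powR mulfV// powRr1//.
rewrite -(ler_pM2l a0) mulVKf ?gt_eqF//.
by apply: le_trans (ld_decr D k); rewrite lerDr.
Qed.

Context (theta01 : 0 < theta < 1).

Let p01 : 0 < 1 - theta < 1.
Proof. by case/andP: theta01 => *; apply/andP; split; lra. Qed.

(** The heart of the argument. By concavity the desingularized gap
    [r ^ (1 - theta)] drops by at least [r ^ (- theta)] times the drop of [r],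
    hence by a multiple of [d k.+1 ^ 2 / d k]; the arithmetic-geometric mean
    inequality makes this linear in the step lengths. *)
Lemma descent_step k :
  2 * d k.+1 <= d k +
    B / (alpha * (1 - theta)) * (r k.+1 `^ (1 - theta) - r k.+2 `^ (1 - theta)).
Proof.
have /andP[p0 p1] := p01; set C := B / _.
set s := r k.+1; set t := r k.+2.
have dec : t + alpha * d k.+1 ^+ 2 <= s := ld_decr D k.+1.
have ts : t <= s := descent_nonincreasing k.+1.
have [s0|sn0] := eqVneq s 0.
  have t0 : t = 0 by apply: le_anti; rewrite r0 -s0 ts.
  have -> : d k.+1 = 0.
    apply/eqP; rewrite -sqrf_eq0 eq_le sqr_ge0 andbT.
    by move: dec; rewrite t0 s0 add0r pmulr_rle0.
  by rewrite s0 t0 subrr !mulr0 addr0.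
have sp : 0 < s by rewrite lt0r sn0 r0.
set Delta := s `^ _ - t `^ _.
have Delta0 : 0 <= Delta.
  by rewrite subr_ge0 ge0_ler_powR ?nnegrE ?r0//; lra.
have C0 : 0 < C by rewrite divr_gt0// mulr_gt0.
have key : d k.+1 ^+ 2 <= d k * (C * Delta).
  have := powR_concave sp (r0 k.+2) p01; rewrite subKr => H1.
  have H2 := ler_wpM2r Delta0 (ld_grad D sp).
  have H3 : alpha * d k.+1 ^+ 2 <= s - t by lra.
  have := ler_wpM2l (ltW p0) H3 => H4.
  have ap : 0 < alpha * (1 - theta) by rewrite mulr_gt0.
  rewrite -(ler_pM2l ap); have -> : alpha * (1 - theta) * (d k * (C * Delta)) =
    B * d k * Delta by rewrite /C; field; rewrite !gt_eqF.
  by move: H1 H2; rewrite -/Delta -/(d k) -/s -/t; lra.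
have CD0 : 0 <= C * Delta by rewrite (mulr_ge0 (ltW C0)).
rewrite -(@ler_pXn2r _ 2)// ?nnegrE ?[0 <= 2 * _]mulr_ge0// ?addr_ge0//.
by have := sqr_ge0 (d k - C * Delta); lra.
Qed.

(** Summing the step estimate telescopes: the length of the path still to be
    travelled is at most [d k + C * r k.+1 ^ (1 - theta)], and it bounds the
    distance to the limit. *)
Lemma descent_distance k :
  enorm (z k.+1 - l) <=
    d k + B / (alpha * (1 - theta)) * r k.+1 `^ (1 - theta).
Proof.
have /andP[p0 p1] := p01; set C := B / _.
have C0 : 0 < C by rewrite divr_gt0// mulr_gt0.
pose W k := d k + C * r k.+1 `^ (1 - theta).
have W0 j : 0 <= W j by rewrite addr_ge0// mulr_ge0 ?powR_ge0// ltW.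
have path j : enorm (z k.+1 - z (k.+1 + j)%N) + W (k + j)%N <= W k.
  elim: j => [|j IH]; first by rewrite !addn0 subrr enorm0 add0r.
  apply: le_trans IH; rewrite !addnS !addSn.
  have := descent_step (k + j); rewrite -/C /W.
  have := enormB_triangle (z k.+1) (z (k + j).+1) (z (k + j).+2).
  rewrite [enorm (z (k + j).+1 - _)]enormBC -/(d _).
  by move=> ? ?; lra.
apply/ler_addgt0Pr => e ep.
have [K _ KP] := (cvg_enormP z l).1 (ld_cvg D) _ ep.
have /= h := KP (k.+1 + K)%N (leq_addl _ _).
have := enormB_triangle (z k.+1) (z (k.+1 + K)%N) l.
by have := path K; have := W0 (k + K)%N; rewrite -/(W k); lra.
Qed.

(** The step is controlled by the square root of the gap, the rest of the path
    by its power [1 - theta]: the smaller of the two exponents governs. *)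
Lemma descent_distance_gap (sigma : R) :
  0 < sigma -> sigma <= 2^-1 -> sigma <= 1 - theta ->
  exists2 M : R, 0 < M & forall k, enorm (z k.+1 - l) <= M * r k `^ sigma.
Proof.
move=> s0 s2 sp; have /andP[p0 p1] := p01.
have A0 : 0 < (alpha^-1) `^ 2^-1 by rewrite powR_gt0 ?invr_gt0.
have C0 : 0 < B / (alpha * (1 - theta)) by rewrite divr_gt0// mulr_gt0.
exists ((alpha^-1) `^ 2^-1 + B / (alpha * (1 - theta))) => [|k].
  by rewrite addr_gt0.
apply: le_trans (descent_distance k) _; rewrite mulrDl; apply: lerD.
  apply: le_trans (step_le_sqrt_gap k) _.
  rewrite powRM ?r0 ?invr_ge0 ?(ltW a0)// ler_pM2l//.
  exact: ge1_powR_antimono (ld_range D k) s0 s2.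
rewrite ler_pM2l//; apply: le_trans (ge1_powR_antimono (ld_range D k) s0 sp).
apply: ge0_ler_powR; rewrite ?nnegrE ?r0 ?(ltW p0)//.
exact: descent_nonincreasing.
Qed.

Lemma gap_recursion k : 0 < r k.+1 ->
  alpha / B ^+ 2 * r k.+1 `^ (2 * theta) <= r k - r k.+1.
Proof.
move=> rp; rewrite -sqr_powR mulrAC ler_pdivrMr ?exprn_gt0//.
have H := ld_grad D rp; have dec := ld_decr D k.
rewrite -/(d k) in H dec.
have : (r k.+1 `^ theta) ^+ 2 <= (B * d k) ^+ 2.
  by rewrite ler_pXn2r// nnegrE ?powR_ge0 ?mulr_ge0// ltW.
rewrite exprMn => H'.
have h1 := ler_wpM2l (ltW a0) H'.
have h2 : alpha * d k ^+ 2 * B ^+ 2 <= (r k - r k.+1) * B ^+ 2.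
  by rewrite ler_pM2r ?exprn_gt0//; lra.
by lra.
Qed.

Lemma descent_linear : theta <= 2^-1 ->
  exists c tau : R, [/\ 0 < c, 0 < tau < 1 &
    forall k, enorm (z k.+1 - l) <= c * tau ^+ k].
Proof.
move=> th2; have /andP[th0 th1] := theta01.
have half0 : 0 < 2^-1 :> R by rewrite invr_gt0.
have half1 : 2^-1 <= 1 - theta by lra.
have [M M0 HM] := descent_distance_gap half0 (lexx _) half1.
have c0 : 0 < alpha / B ^+ 2 by rewrite divr_gt0// exprn_gt0.
set c := alpha / _ in c0.
have lin k : c * r k.+1 <= r k - r k.+1.
  have [->|rn0] := eqVneq (r k.+1) 0; first by rewrite mulr0 subr0.
  have rp : 0 < r k.+1 by rewrite lt0r rn0 r0.
  apply: le_trans (gap_recursion rp); rewrite ler_pM2l//.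
  rewrite -[X in X <= _]powRr1 ?r0//.
  apply: ge1_powR_antimono (ld_range D _) _ _; last by lra.
  by rewrite mulr_gt0.
have q0 : 0 < (1 + c)^-1 by rewrite invr_gt0; lra.
exists M, ((1 + c)^-1 `^ 2^-1); split => //.
  have one : 1 `^ 2^-1 = 1 :> R by rewrite powR1.
  rewrite powR_gt0//= -[ltRHS]one gt0_ltr_powR ?invr_gt0// ?nnegrE ?(ltW q0)//.
  by rewrite invf_lt1; lra.
move=> k; apply: le_trans (HM k) _; rewrite ler_pM2l//.
rewrite -powR_mulrn ?powR_ge0// -powRrM mulrC powRrM.
rewrite powR_mulrn ?(ltW q0)//.
apply: ge0_ler_powR; rewrite ?nnegrE ?r0 ?invr_ge0 ?exprn_ge0 ?(ltW q0)//.
apply: le_trans (geometric_decay c0 lin k) _.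
by rewrite ler_piMl ?exprn_ge0 ?(ltW q0)//; case/andP: (ld_range D 0).
Qed.

Lemma descent_sublinear : 2^-1 < theta ->
  exists2 c : R, 0 < c & forall k, (0 < k)%N ->
    enorm (z k.+1 - l) <= c * k%:R `^ (- ((1 - theta) / (2 * theta - 1))).
Proof.
move=> th2; have /andP[th0 th1] := theta01; have /andP[p0 p1] := p01.
have p2 : 1 - theta <= 2^-1 by lra.
have [M M0 HM] := descent_distance_gap p0 p2 (lexx _).
have c0 : 0 < alpha / B ^+ 2 by rewrite divr_gt0// exprn_gt0.
set nu := 2 * theta - 1; have nu01 : 0 < nu < 1 by rewrite /nu; apply/andP; lra.
have [nu0 nu1] := andP nu01.
have rec k : 0 < r k.+1 ->
    alpha / B ^+ 2 * r k.+1 `^ (1 + nu) <= r k - r k.+1.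
  by rewrite /nu addrC subrK; exact: gap_recursion.
have [e e0 He] := power_decay c0 nu01 (ld_range D) descent_nonincreasing rec.
set beta := (1 - theta) / nu; have b0 : 0 < beta by rewrite divr_gt0.
exists (M * e `^ (- beta)) => [|k k0]; first by rewrite mulr_gt0// powR_gt0.
have k0' : 0 < k%:R :> R by rewrite ltr0n.
apply: le_trans (HM k) _; rewrite -mulrA ler_pM2l//.
rewrite -powRM ?(ltW e0) ?(ltW k0')// powRN.
have -> : r k `^ (1 - theta) = (r k `^ nu) `^ beta.
  by rewrite -powRrM /beta mulrC divfK// gt_eqF.
have ek0 : 0 < e * k%:R by rewrite mulr_gt0.
rewrite -[leRHS]mul1r ler_pdivlMr ?powR_gt0// -powRM ?powR_ge0 ?(ltW ek0)//.
have one : 1 `^ beta = 1 :> R by rewrite powR1.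
rewrite -[leRHS]one; apply: ge0_ler_powR; rewrite ?nnegrE ?(ltW b0)//.
  by rewrite mulr_ge0 ?powR_ge0// ltW.
by rewrite mulrC; exact: He.
Qed.

End descent.

(** * First-order expansions and Frechet subgradients *)

Definition first_order (R : realType) N (q : 'rV[R]_N -> R) (x G : 'rV[R]_N) :=
  forall e : R, 0 < e -> \forall u \near x,
    `|q u - q x - dot G (u - x)| <= e * enorm (u - x).

(** The defining inequality of a Frechet subgradient with the quotient and the
    lower limit cleared, which is the form in which it can be added up. *)
Definition first_order_minorant (R : realType) N (h : 'rV[R]_N -> \bar R)
    (x p : 'rV[R]_N) :=
  forall e : R, 0 < e -> \forall u \near x,
    (h x + (dot p (u - x) - e * enorm (u - x))%:E <= h u)%E.

Lemma minorant_frechet (R : realType) N (h : 'rV[R]_N -> \bar R)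
    (x p : 'rV[R]_N) :
  h x \is a fin_num -> first_order_minorant h x p -> frechet_subdiff h x p.
Proof.
move=> hx H; split; first by rewrite ltey_eq hx.
rewrite limf_einfE; apply/lee_addgt0Pr => e e0.
rewrite -leeBlDr// sub0e; set A := [set y : 'rV[R]_N | y != x /\
  (h x + (dot p (y - x) - e * enorm (y - x))%:E <= h y)%E].
apply: (@le_trans _ _ (ereal_inf [set ((enorm (x - y))^-1)%:E *
    (h y - h x - (dot p (y - x))%:E) | y in A]))%E; last first.
  apply: ereal_sup_ubound; exists A => //; rewrite /dnbhs /within /=.
  by apply: filterS (H e e0) => y Hy yx; split.
apply: le_ereal_inf_tmp => _ [y [yx Hy] <-].
have d0 : 0 < enorm (x - y).
  rewrite lt0r enorm_ge0 andbT; apply: contraNneq yx => xy0.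
  by rewrite eq_sym -subr_eq0; apply/eqP/enorm_eq0; rewrite xy0.
case: (h x) hx Hy => // hx _; case: (h y) => [hy||//].
  rewrite -!EFinD lee_fin /= => Hy.
  rewrite lee_fin mulrC ler_pdivlMr//.
  by move: Hy; rewrite [enorm (y - x)]enormBC; lra.
by move=> _; rewrite !addye// gt0_muley ?leey// lte_fin invr_gt0.
Qed.

Lemma frechet_limiting (R : realType) N (h : 'rV[R]_N -> \bar R)
    (x p : 'rV[R]_N) :
  frechet_subdiff h x p -> limiting_subdiff h x p.
Proof.
move=> H; split; first by case: H.
by exists (fun=> x), (fun=> p); split => //; exact: cvg_cst.
Qed.

Lemma diff_gradient (R : realType) N (q : 'rV[R]_N -> R) (x v : 'rV[R]_N) :
  differentiable q x -> 'd q x v = dot (gradient q x) v.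
Proof.
move=> dq; rewrite [in LHS](row_sum_delta v) linear_sum.
by apply: eq_bigr => i _; rewrite linearZ /= !mxE deriveE// mulrC.
Qed.

Lemma gradient_expansion (R : realType) N (q : 'rV[R]_N -> R) (x : 'rV[R]_N) :
  differentiable q x -> first_order q x (gradient q x).
Proof.
move=> dq e e0; have E := diff_locallyx dq.
set o := ('o_ _ _) in E.
have /= := littleoP o e0; rewrite -/(nbhs _ _) => /near_enormP[d d0 dP].
apply/near_enormP; exists d => // u ud.
have := dP (u - x); rewrite subr0 => /(_ ud).
have := E (u - x); rewrite subrK => ->; rewrite diff_gradient//.
rewrite (_ : _ - _ - _ = o (u - x)) => [H|]; last by ring.
by apply: le_trans H _; rewrite ler_pM2l// norm_le_enorm.
Qed.

Lemma first_orderD (R : realType) N (q q' : 'rV[R]_N -> R) (x G G' : 'rV[R]_N) :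
  first_order q x G -> first_order q' x G' ->
  first_order (fun u => q u + q' u) x (G + G').
Proof.
move=> H H' e e0; have e2 : 0 < e / 2 by rewrite divr_gt0.
apply: filterS2 (H _ e2) (H' _ e2) => u; rewrite dotDl => h h'.
have -> : q u + q' u - (q x + q' x) - (dot G (u - x) + dot G' (u - x)) =
  (q u - q x - dot G (u - x)) + (q' u - q' x - dot G' (u - x)) by ring.
by apply: le_trans (ler_normD _ _) _; lra.
Qed.

Lemma first_order_sqdist (R : realType) N (c : R) (x0 x : 'rV[R]_N) :
  first_order (fun u => c * enorm (u - x0) ^+ 2) x ((2 * c) *: (x - x0)).
Proof.
move=> e e0; apply/near_enormP; exists (e / (`|c| + 1)).
  by rewrite divr_gt0// ltr_wpDl.
move=> u; rewrite ltr_pdivlMr ?ltr_wpDl// => ux.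
have -> : u - x0 = (u - x) + (x - x0) by rewrite addrA subrK.
rewrite [X in c * X - _]sqr_enormD dotZl [dot (u - x) _]dotC.
have -> : c * (enorm (u - x) ^+ 2 + 2 * dot (x - x0) (u - x) +
    enorm (x - x0) ^+ 2) - c * enorm (x - x0) ^+ 2 -
    2 * c * dot (x - x0) (u - x) = c * enorm (u - x) * enorm (u - x) by ring.
rewrite normrM [`|enorm _|]ger0_norm ?enorm_ge0// ler_wpM2r ?enorm_ge0//.
rewrite normrM [`|enorm _|]ger0_norm ?enorm_ge0//.
by have := enorm_ge0 (u - x); lra.
Qed.

Lemma first_order_rowl (R : realType) n m (Q : 'rV[R]_(n + m) -> R)
    (x : 'rV[R]_n) (y : 'rV[R]_m) (G : 'rV[R]_(n + m)) :
  first_order Q (row_mx x y) G ->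
  first_order (fun u => Q (row_mx u y)) x (lsubmx G).
Proof.
move=> H e e0; have /near_enormP[d d0 dP] := H e e0.
apply/near_enormP; exists d => // u ud.
have := dP (row_mx u y); rewrite row_mxBl enorm_row0r => /(_ ud).
by rewrite -{1}[G]hsubmxK dot_row_mx dot0r addr0.
Qed.

Lemma first_order_rowr (R : realType) n m (Q : 'rV[R]_(n + m) -> R)
    (x : 'rV[R]_n) (y : 'rV[R]_m) (G : 'rV[R]_(n + m)) :
  first_order Q (row_mx x y) G ->
  first_order (fun v => Q (row_mx x v)) y (rsubmx G).
Proof.
move=> H e e0; have /near_enormP[d d0 dP] := H e e0.
apply/near_enormP; exists d => // v vd.
have := dP (row_mx x v); rewrite row_mxBr enorm_row0l => /(_ vd).
by rewrite -{1}[G]hsubmxK dot_row_mx dot0r add0r.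
Qed.

(** Fermat's rule. *)
Lemma argmin_minorant (R : realType) N (f : 'rV[R]_N -> \bar R)
    (q : 'rV[R]_N -> R) (x G : 'rV[R]_N) :
  f x \is a fin_num -> argmin (fun u => f u + (q u)%:E)%E x ->
  first_order q x G -> first_order_minorant f x (- G).
Proof.
move=> fx H Hq e e0; apply: filterS (Hq e e0) => u; have := H u.
case: (f x) fx => // a _; case: (f u) => [b||]; last by [].
  rewrite -!EFinD !lee_fin dotNl => h; rewrite ler_norml => /andP[_ h'].
  by lra.
by move=> _ _; rewrite leey.
Qed.

Lemma minorant_separable (R : realType) n m (f : 'rV[R]_n -> \bar R)
    (g : 'rV[R]_m -> \bar R) (Q : 'rV[R]_(n + m) -> R)
    (L : 'rV[R]_(n + m) -> \bar R)
    (x p : 'rV[R]_n) (y q : 'rV[R]_m) (G : 'rV[R]_(n + m)) :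
  (forall u, (-oo < f u)%E) -> (forall v, (-oo < g v)%E) ->
  (forall u v, L (row_mx u v) = (f u + (Q (row_mx u v))%:E + g v)%E) ->
  f x \is a fin_num -> g y \is a fin_num ->
  first_order_minorant f x p -> first_order_minorant g y q ->
  first_order Q (row_mx x y) G ->
  first_order_minorant L (row_mx x y) (row_mx p q + G).
Proof.
move=> f0 g0 LE fx gy Hf Hg HQ e e0; have e3 : 0 < e / 3 by rewrite divr_gt0.
have /near_enormP[a a0 aP] := Hf _ e3.
have /near_enormP[b b0 bP] := Hg _ e3.
have /near_enormP[c c0 cP] := HQ _ e3.
apply/near_enormP; exists (Num.min a (Num.min b c)) => [|w].
  by rewrite !lt_min a0 b0 c0.
rewrite !lt_min => /and3P[wa wb wc]; have := cP w wc.
move: wa wb {wc cP}; rewrite -[w]hsubmxK; move: (lsubmx w) (rsubmx w) => u v.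
rewrite opp_row_mx add_row_mx => wa wb; rewrite dotDl dot_row_mx !LE.
have ule := enorm_rowl (u - x) (v - y).
have vle := enorm_rowr (u - x) (v - y).
have := ler_wpM2l (ltW e3) vle; have := ler_wpM2l (ltW e3) ule.
have := aP u (le_lt_trans ule wa); have := bP v (le_lt_trans vle wb).
have := f0 u; have := g0 v.
case: (f x) fx => // fx _; case: (g y) gy => // gy _.
case: (f u) => [fu||//]; case: (g v) => [gv||//] _ _; rewrite ?leey//.
rewrite -!EFinD !lee_fin ler_norml => h1 h2 h3 h4 /andP[h5 _].
by lra.
Qed.

(** * Proximal steps *)

Lemma argmin_addr (R : realType) (T : Type) (F G : T -> \bar R) (b : \bar R)
    (x : T) :
  b \is a fin_num -> (forall u, F u = (G u + b)%E) -> argmin F x -> argmin G x.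
Proof. by move=> bfin FE H u; have := H u; rewrite !FE leeD2rE. Qed.

Lemma argmin_fin_num (R : realType) (T : Type) (f : T -> \bar R) (q : T -> R)
    (x : T) :
  proper_efun f -> argmin (fun u => f u + (q u)%:E)%E x -> f x \is a fin_num.
Proof.
move=> [fNy [u fu]] H; rewrite fin_numE -ltNye -ltey fNy /=.
have := H u; move: (fNy u) fu; case: (f u) => // a _ _.
by case: (f x) => // b; rewrite ltry.
Qed.

Lemma argmin_fine_le (R : realType) (T : Type) (f : T -> \bar R) (q : T -> R)
    (x u : T) :
  f x \is a fin_num -> f u \is a fin_num ->
  argmin (fun u => f u + (q u)%:E)%E x -> fine (f x) + q x <= fine (f u) + q u.
Proof.
move=> fx fu /(_ u); move: fx fu.
by case: (f x) => // a _; case: (f u) => // b _; rewrite -!EFinD lee_fin.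
Qed.

(** Lower semicontinuity bounds the values from below in the limit. Along
    minimizers the converse bound holds too, because the limit point is itself
    a competitor; [eps k] is what testing the [k]-th problem at [l] costs. *)
Lemma cvg_argmin_value (R : realType) N (f : 'rV[R]_N -> \bar R)
    (x : nat -> 'rV[R]_N) (l : 'rV[R]_N) (eps : nat -> R) :
  lower_semicontinuous f -> x k @[k --> \oo] --> l -> f l \is a fin_num ->
  (forall k, f (x k) \is a fin_num) ->
  (forall k, fine (f (x k)) <= fine (f l) + eps k) ->
  eps k @[k --> \oo] --> (0 : R) ->
  fine (f (x k)) @[k --> \oo] --> fine (f l).
Proof.
move=> flsc xl fl fx H epsl; apply/cvgrPdist_lt => e e0.
have [|V Vl VP] := flsc l (fine (f l) - e).
  by rewrite -[X in (_ < X)%E]fineK// lte_fin ltrBlDr ltrDl.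
have h1 : \forall k \near \oo, V (x k) by exact: xl.
have /cvgrPdist_lt/(_ _ e0) h2 := epsl.
near=> k; have : V (x k) by near: k.
move/VP; rewrite -[X in (_ < X)%E -> _]fineK// lte_fin => lo.
have : `|0 - eps k| < e by near: k.
rewrite sub0r normrN ltr_norml => /andP[_ up].
by have := H k; rewrite ltr_norml => hk; apply/andP; split; lra.
Unshelve. all: by end_near. Qed.

(** * The Kurdyka-Lojasiewicz inequality for a power *)

Lemma derive1_scaled_powR (R : realType) (a p s : R) :
  0 < s -> derive1 (fun t : R => a * t `^ p) s = a * (p * s `^ (p - 1)).
Proof.
move=> s0; have [ds <-] := is_derive1_powR p s0.
by rewrite derive1Ml// derive1E.
Qed.

Lemma KL_power_slope (R : realType) N (h : 'rV[R]_N -> \bar R)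
    (xbar : 'rV[R]_N) (a theta : R) :
  0 < a -> theta < 1 ->
  h xbar \is a fin_num ->
  KL_property h xbar (fun s : R => a * s `^ (1 - theta)) ->
  exists2 delta : R, 0 < delta & \forall x \near xbar, forall p,
    frechet_subdiff h x p -> h x \is a fin_num ->
    0 < fine (h x) - fine (h xbar) < delta ->
    (fine (h x) - fine (h xbar)) `^ theta <= a * (1 - theta) * enorm p.
Proof.
move=> a0 th1 hfin [_ [eta [U [eta0 Ux _ HU]]]].
have [delta d0 deta] : exists2 d : R, 0 < d & (d%:E <= eta)%E.
  case: eta eta0 {HU} => [e|_|//]; first by rewrite lte_fin => e0; exists e.
  by exists 1; rewrite ?leey.
exists delta => //; apply: filterS Ux => x Ux p hp hx.
have := HU x Ux; move: hx hfin; have := frechet_limiting hp.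
set K := limiting_subdiff h x => Kp.
case: (h x) => // hx _; case: (h xbar) => // hb _ /= H /andP[s0 s1].
have := H; rewrite lte_fin -subr_gt0 s0 => /(_ isT).
have -> : (hx%:E < hb%:E + eta)%E.
  apply: (@lt_le_trans _ _ (hb%:E + delta%:E)%E); last by rewrite leeD2lE.
  by rewrite -EFinD lte_fin -ltrBlDl.
move=> /(_ isT); rewrite /= derive1_scaled_powR//.
set s := hx - hb in s0 s1 *.
have -> : 1 - theta - 1 = - theta by ring.
have cp : 0 < a * ((1 - theta) * s `^ (- theta)).
  by rewrite !mulr_gt0 ?subr_gt0// powR_gt0.
move=> H1.
have : (1 <= (a * ((1 - theta) * s `^ (- theta)))%:E * (enorm p)%:E)%E.
  apply: le_trans H1 _; rewrite lee_pmul2l//.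
  by apply: ereal_inf_lbound; exists p => //; rewrite sub0r enormN.
rewrite -EFinM lee_fin powRN => H2.
have sp : 0 < s `^ theta by exact: powR_gt0.
have := ler_wpM2l (ltW sp) H2; rewrite mulr1 => /le_trans; apply.
by rewrite le_eqVlt; apply/orP; left; apply/eqP; field; rewrite gt_eqF.
Qed.

(** * Alternating proximal minimization *)

Section alternating.
Context (R : realType) (n m : nat).
Context (f : 'rV[R]_n -> \bar R) (g : 'rV[R]_m -> \bar R).
Context (Q : 'rV[R]_(n + m) -> R) (L : 'rV[R]_(n + m) -> \bar R).
Context (f_proper : proper_efun f) (f_lsc : lower_semicontinuous f).
Context (g_proper : proper_efun g) (g_lsc : lower_semicontinuous g).
Context (Q_C1 : C1 Q) (Q_lip : lipschitz_on_bounded_sets (gradient Q)).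
Context (L_def : forall (u : 'rV[R]_n) (v : 'rV[R]_m),
  L (row_mx u v) = (f u + (Q (row_mx u v))%:E + g v)%E).
Context (x : nat -> 'rV[R]_n) (y : nat -> 'rV[R]_m).
Context (L_proper : proper_efun (fun u : 'rV[R]_n => L (row_mx u (y 0%N)))).
Context (rm rp : R) (lambda mu : nat -> R) (hr : 0 < rm < rp).
Context (hlambda : forall k, rm < lambda k < rp).
Context (hmu : forall k, rm < mu k < rp).
Context (hx : forall k, argmin (fun u : 'rV[R]_n =>
  (L (row_mx u (y k)) + ((2 * lambda k)^-1 * enorm (u - x k) ^+ 2)%:E)%E)
  (x k.+1)).
Context (hy : forall k, argmin (fun v : 'rV[R]_m =>
  (L (row_mx (x k.+1) v) + ((2 * mu k)^-1 * enorm (v - y k) ^+ 2)%:E)%E)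
  (y k.+1)).

Let Z k := row_mx (x k) (y k).
Let W k := row_mx (x k.+1) (y k).

Let px k (u : 'rV[R]_n) :=
  Q (row_mx u (y k)) + (2 * lambda k)^-1 * enorm (u - x k) ^+ 2.
Let py k (v : 'rV[R]_m) :=
  Q (row_mx (x k.+1) v) + (2 * mu k)^-1 * enorm (v - y k) ^+ 2.

Let argmin_x k : g (y k) \is a fin_num ->
  argmin (fun u => f u + (px k u)%:E)%E (x k.+1).
Proof.
move=> gk; apply: (argmin_addr gk _ (hx k)) => u.
by rewrite L_def /px EFinD addeA [LHS]addeAC.
Qed.

Let argmin_y k : f (x k.+1) \is a fin_num ->
  argmin (fun v => g v + (py k v)%:E)%E (y k.+1).
Proof.
move=> fk; apply: (argmin_addr fk _ (hy k)) => v.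
by rewrite L_def /py EFinD [LHS]addeAC [RHS]addeC [(g v + _)%E]addeC !addeA.
Qed.

Let g_fin k : g (y k) \is a fin_num.
Proof.
elim: k => [|k IH].
  have [_ [u]] := L_proper; rewrite L_def fin_numE -ltNye -ltey g_proper.1 /=.
  have := f_proper.1 u; have := g_proper.1 (y 0%N).
  by case: (f u) => // a; case: (g _) => // b; rewrite ltry.
exact: (argmin_fin_num g_proper
  (argmin_y (argmin_fin_num f_proper (argmin_x IH)))).
Qed.

Let f_fin k : f (x k.+1) \is a fin_num.
Proof. exact: (argmin_fin_num f_proper (argmin_x (g_fin k))). Qed.

Let V k := fine (f (x k)) + Q (Z k) + fine (g (y k)).

Let LE u v : f u \is a fin_num -> g v \is a fin_num ->
  L (row_mx u v) = (fine (f u) + Q (row_mx u v) + fine (g v))%:E.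
Proof. by move=> fu gv; rewrite L_def !EFinD !fineK. Qed.

Let inv_bounds (s : R) : rm < s < rp ->
  (2 * rp)^-1 <= (2 * s)^-1 <= (2 * rm)^-1.
Proof.
have /andP[rm0 _] := hr; move=> /andP[s1 s2].
by rewrite !lef_pV2 ?posrE ?mulr_gt0// ?ler_pM2l// ?(ltW s1) ?(ltW s2)//; lra.
Qed.

(** Comparing each block minimizer with the previous value of that block. The
    initial value may be infinite, hence the restriction on [k]. *)
Lemma alternating_decrease k : (0 < k)%N ->
  V k.+1 + (2 * rp)^-1 * enorm (Z k.+1 - Z k) ^+ 2 <= V k.
Proof.
case: k => // k _.
have := argmin_fine_le (f_fin k.+1) (f_fin k) (argmin_x (g_fin k.+1)).
have := argmin_fine_le (g_fin k.+2) (g_fin k.+1) (argmin_y (f_fin k.+1)).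
rewrite /px /py !subrr !enorm0 /V /Z opp_row_mx add_row_mx enorm_row_mx.
have /andP[l1 _] := inv_bounds (hlambda k.+1).
have /andP[m1 _] := inv_bounds (hmu k.+1).
have := ler_wpM2r (sqr_ge0 (enorm (x k.+2 - x k.+1))) l1.
have := ler_wpM2r (sqr_ge0 (enorm (y k.+2 - y k.+1))) m1.
by rewrite !expr0n /=; lra.
Qed.

(** Fermat's rule in each block gives a subgradient of [L] at the new point:
    the proximal terms contribute multiples of the step, and the gradient of
    the coupling differs from the one used in the first block by its variation
    between [W k] and [Z k.+1]. *)
Lemma alternating_subgradient k : exists2 p,
  frechet_subdiff L (Z k.+1) p &
  enorm p <= enorm (gradient Q (Z k.+1) - gradient Q (W k)) +
             2 / rm * enorm (Z k.+1 - Z k).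
Proof.
have /andP[rm0 _] := hr.
set c := (2 * lambda k)^-1; set c' := (2 * mu k)^-1.
set G := gradient Q (W k); set G' := gradient Q (Z k.+1).
set a := (2 * c) *: (x k.+1 - x k); set b := (2 * c') *: (y k.+1 - y k).
have Hx : first_order_minorant f (x k.+1) (- (lsubmx G + a)).
  apply: argmin_minorant (f_fin k) (argmin_x (g_fin k)) _.
  apply: first_orderD (first_order_rowl _) (first_order_sqdist _ _ _).
  exact: gradient_expansion (Q_C1.1 _).
have HZ := gradient_expansion (Q_C1.1 (Z k.+1)).
have Hy : first_order_minorant g (y k.+1) (- (rsubmx G' + b)).
  apply: argmin_minorant (g_fin k.+1) (argmin_y (f_fin k)) _.
  exact: first_orderD (first_order_rowr HZ) (first_order_sqdist _ _ _).
exists (row_mx (- (lsubmx G + a)) (- (rsubmx G' + b)) + G').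
  apply: minorant_frechet; first by rewrite LE.
  by apply: minorant_separable L_def _ _ Hx Hy HZ => //;
    [exact: f_proper.1|exact: g_proper.1].
have -> : row_mx (- (lsubmx G + a)) (- (rsubmx G' + b)) + G' =
    row_mx (lsubmx (G' - G)) 0 + - row_mx a b.
  rewrite -{2}[G']hsubmxK !add_row_mx opp_row_mx linearB /= add_row_mx.
  congr row_mx; rewrite opprD addrAC; last by rewrite addNr.
  by rewrite [- _ + _]addrC.
apply: le_trans (enormD _ _) _; rewrite enormN enorm_row0r.
apply: lerD; first exact: enorm_lsubmx.
apply: le_trans (enorm_row_le _ _) _; rewrite /a /b !enormZ.
have /andP[_ l1] := inv_bounds (hlambda k).
have /andP[_ m1] := inv_bounds (hmu k).
have [/andP[l0 _] /andP[m0 _]] := (hlambda k, hmu k).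
have c0 : 0 <= c by rewrite invr_ge0; lra.
have c0' : 0 <= c' by rewrite invr_ge0; lra.
rewrite !ger0_norm ?mulr_ge0//.
have zx : enorm (x k.+1 - x k) <= enorm (Z k.+1 - Z k).
  by rewrite /Z opp_row_mx add_row_mx enorm_rowl.
have zy : enorm (y k.+1 - y k) <= enorm (Z k.+1 - Z k).
  by rewrite /Z opp_row_mx add_row_mx enorm_rowr.
have rE : 2 * (2 * rm)^-1 = rm^-1 by field; rewrite gt_eqF.
have bnd s e : 0 <= s -> s <= (2 * rm)^-1 -> 0 <= e ->
    e <= enorm (Z k.+1 - Z k) -> 2 * s * e <= rm^-1 * enorm (Z k.+1 - Z k).
  move=> s0 s1 e0 e1; apply: ler_pM => //; first by rewrite mulr_ge0.
  by rewrite -rE ler_pM2l.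
have := bnd _ _ c0 l1 (enorm_ge0 _) zx; have := bnd _ _ c0' m1 (enorm_ge0 _) zy.
by lra.
Qed.

Context (xoo : 'rV[R]_n) (yoo : 'rV[R]_m).
Context (hcvg : Z k @[k --> \oo] --> row_mx xoo yoo).

Let x_cvg : x k @[k --> \oo] --> xoo. Proof. exact: cvg_lrow hcvg. Qed.
Let y_cvg : y k @[k --> \oo] --> yoo. Proof. exact: cvg_rrow hcvg. Qed.
Let xS_cvg : x k.+1 @[k --> \oo] --> xoo.
Proof. by rewrite (@cvg_shiftS _ x (nbhs xoo)). Qed.
Let yS_cvg : y k.+1 @[k --> \oo] --> yoo.
Proof. by rewrite (@cvg_shiftS _ y (nbhs yoo)). Qed.
Let W_cvg : W k @[k --> \oo] --> row_mx xoo yoo.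
Proof. exact: cvg_row_mx xS_cvg y_cvg. Qed.
Let ZS_cvg : Z k.+1 @[k --> \oo] --> row_mx xoo yoo.
Proof. exact: cvg_row_mx xS_cvg yS_cvg. Qed.

Let Q_cvg (w : nat -> 'rV[R]_(n + m)) l :
  w k @[k --> \oo] --> l -> Q (w k) @[k --> \oo] --> Q l.
Proof.
move=> wl; apply: (cvg_comp w Q wl).
exact: differentiable_continuous (Q_C1.1 l).
Qed.

Context (L_fin : L (row_mx xoo yoo) \is a fin_num).

Let f_oo : f xoo \is a fin_num.
Proof.
have := L_fin; rewrite L_def; have := f_proper.1 xoo; have := g_proper.1 yoo.
by case: (f xoo) => //; case: (g yoo).
Qed.

Let g_oo : g yoo \is a fin_num.
Proof.
have := L_fin; rewrite L_def; have := f_proper.1 xoo; have := g_proper.1 yoo.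
by case: (f xoo) => //; case: (g yoo).
Qed.

Let prox_cvg0 N (c : nat -> R) (u : nat -> 'rV[R]_N) (l : 'rV[R]_N) :
  (forall k, rm < c k < rp) -> u k @[k --> \oo] --> l ->
  (2 * c k)^-1 * enorm (l - u k) ^+ 2 @[k --> \oo] --> (0 : R).
Proof.
move=> hc ul; have /andP[rm0 _] := hr.
have up : (2 * rm)^-1 * (enorm (u k - l) * enorm (u k - l))
    @[k --> \oo] --> (0 : R).
  have -> : (0 : R) = (2 * rm)^-1 * (0 * 0) by rewrite !mulr0.
  by apply: cvgM; [exact: cvg_cst|apply: cvgM; exact: cvg_enorm0].
apply: (@squeeze_cvgr _ _ _ _ (fun=> 0) _ _ _ _ (cvg_cst _) up).
apply: nearW => k; have /andP[c1 c2] := inv_bounds (hc k).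
have r0 : 0 <= (2 * rp)^-1 by rewrite invr_ge0 mulr_ge0//; case/andP: hr; lra.
rewrite enormBC -expr2 ler_wpM2r ?sqr_ge0// andbT mulr_ge0 ?sqr_ge0//.
exact: le_trans r0 c1.
Qed.

(** Each block problem is tested at the corresponding block of the limit. The
    cost of this test is a difference of two values of [Q] along sequences with
    the same limit, plus a proximal term, and so it vanishes. *)
Lemma alternating_value_cvg :
  V k.+1 @[k --> \oo] --> fine (L (row_mx xoo yoo)).
Proof.
have Qoo (w w' : nat -> 'rV[R]_(n + m)) (e : nat -> R) :
    w k @[k --> \oo] --> row_mx xoo yoo ->
    w' k @[k --> \oo] --> row_mx xoo yoo -> e k @[k --> \oo] --> (0 : R) ->
    Q (w k) - Q (w' k) + e k @[k --> \oo] --> (0 : R).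
  move=> wl wl' el.
  have -> : (0 : R) = Q (row_mx xoo yoo) - Q (row_mx xoo yoo) + 0.
    by rewrite subrr addr0.
  by apply: cvgD el; apply: cvgB; exact: Q_cvg.
have cst N (v : 'rV[R]_N) : v @[k --> \oo] --> v by exact: cvg_cst.
have /andP[rm0 _] := hr.
have f_cvg : fine (f (x k.+1)) @[k --> \oo] --> fine (f xoo).
  have eps0 := Qoo _ _ _ (cvg_row_mx (cst _ xoo) y_cvg) W_cvg
    (prox_cvg0 hlambda x_cvg).
  apply: (cvg_argmin_value f_lsc xS_cvg f_oo f_fin _ eps0) => k.
  have := argmin_fine_le (f_fin k) f_oo (argmin_x (g_fin k)).
  have /andP[l0 _] := hlambda k.
  have : 0 <= (2 * lambda k)^-1 * enorm (x k.+1 - x k) ^+ 2.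
    by rewrite mulr_ge0 ?sqr_ge0// invr_ge0; lra.
  by rewrite /px /W; lra.
have g_cvg : fine (g (y k.+1)) @[k --> \oo] --> fine (g yoo).
  have eps0 := Qoo _ _ _ (cvg_row_mx xS_cvg (cst _ yoo)) ZS_cvg
    (prox_cvg0 hmu y_cvg).
  apply: (cvg_argmin_value g_lsc yS_cvg g_oo (fun k => g_fin k.+1) _ eps0) => k.
  have := argmin_fine_le (g_fin k.+1) g_oo (argmin_y (f_fin k)).
  have /andP[m0 _] := hmu k.
  have : 0 <= (2 * mu k)^-1 * enorm (y k.+1 - y k) ^+ 2.
    by rewrite mulr_ge0 ?sqr_ge0// invr_ge0; lra.
  by rewrite /py /Z; lra.
rewrite LE//=; exact: cvgD (cvgD f_cvg (Q_cvg ZS_cvg)) g_cvg.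
Qed.

Lemma alternating_value_ge k : fine (L (row_mx xoo yoo)) <= V k.+1.
Proof.
rewrite -(cvg_lim (@Rhausdorff R) alternating_value_cvg).
apply: (@nonincreasing_cvgn_ge R (fun k => V k.+1)); last first.
  by apply/cvg_ex; eexists; exact: alternating_value_cvg.
apply/nonincreasing_seqP => j.
apply: le_trans (alternating_decrease (ltn0Sn j)).
rewrite lerDl mulr_ge0 ?sqr_ge0// invr_ge0 mulr_ge0//.
by case/andP: hr; lra.
Qed.

Context (theta a : R) (theta1 : theta < 1) (a_gt0 : 0 < a).
Context (hKL : KL_property L (row_mx xoo yoo)
  (fun s : R => a * s `^ (1 - theta))).

Lemma alternating_lojasiewicz_descent : exists K (alpha B : R) r,
  lojasiewicz_descent (fun k => Z (K + k)) (row_mx xoo yoo) r alpha B theta.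
Proof.
have /andP[rm0 rmp] := hr.
have [delta d0 KL] := KL_power_slope a_gt0 theta1 L_fin hKL.
have [C HC] := Q_lip (enorm_lt1_bounded (row_mx xoo yoo)).
have nearW1 := (cvg_enormP _ _).1 W_cvg 1 ltr01.
have nearZ1 := (cvg_enormP _ _).1 ZS_cvg 1 ltr01.
have dp : 0 < Num.min delta 1 by rewrite lt_min d0 ltr01.
have /cvgrPdist_lt/(_ _ dp) nearV := alternating_value_cvg.
have nearKL := ZS_cvg KL.
have [K _ HK] : \forall k \near \oo,
    [/\ enorm (W k - row_mx xoo yoo) < 1, enorm (Z k.+1 - row_mx xoo yoo) < 1,
        `|fine (L (row_mx xoo yoo)) - V k.+1| < Num.min delta 1 &
        forall p, frechet_subdiff L (Z k.+1) p -> L (Z k.+1) \is a fin_num ->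
          0 < fine (L (Z k.+1)) - fine (L (row_mx xoo yoo)) < delta ->
          (fine (L (Z k.+1)) - fine (L (row_mx xoo yoo))) `^ theta <=
            a * (1 - theta) * enorm p].
  by near=> k; split; near: k.
pose r k := V (K.+1 + k)%N - fine (L (row_mx xoo yoo)).
have C0 : 0 < a * (1 - theta) * (`|C| + 2 / rm).
  by rewrite !mulr_gt0 ?subr_gt0// ltr_wpDl// divr_gt0.
(* [`|C|], because a Lipschitz constant on a trivial set may be negative *)
exists K.+1, ((2 * rp)^-1), (a * (1 - theta) * (`|C| + 2 / rm)), r.
split => //.
- by rewrite invr_gt0; lra.
- apply/cvg_enormP => e e0; have [k0 _ Hk0] := (cvg_enormP Z _).1 hcvg e e0.
  by exists k0 => // k k0k; apply: Hk0; exact: leq_trans k0k (leq_addl _ _).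
- move=> k; have /= [_ _ h _] := HK (K + k)%N (leq_addr _ _).
  move: h; rewrite distrC ger0_norm ?subr_ge0 ?alternating_value_ge//.
  by rewrite lt_min /r addSn => /andP[_ /ltW ->].
- move=> k; rewrite /r addnS; have := @alternating_decrease (K.+1 + k)%N isT.
  by lra.
move=> k; rewrite /r /= !addnS !addSn => rk.
have /= [Wk Zk] := HK (K + k).+1 (leqW (leq_addr _ _)).
rewrite distrC ger0_norm ?subr_ge0 ?alternating_value_ge// lt_min.
move=> /andP[Vd _].
have [p pL ple] := alternating_subgradient (K + k).+1.
have LZ : L (Z (K + k).+2) = (V (K + k).+2)%:E by rewrite LE.
move=> /(_ p pL); rewrite LZ rk Vd => /(_ isT isT) /= H.
apply: le_trans H _; rewrite -!mulrA ler_pM2l// ler_pM2l ?subr_gt0//.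
apply: le_trans ple _; rewrite [leRHS]mulrDl lerD2r.
apply: le_trans (HC _ _ Zk Wk) _.
apply: le_trans (ler_wpM2r (enorm_ge0 _) (ler_norm C)) _.
rewrite ler_wpM2l// /Z /W row_mxBr enorm_row0l opp_row_mx add_row_mx.
exact: enorm_rowr.
Unshelve. all: by end_near. Qed.

End alternating.

(** * Rates of convergence of the iterates *)

Theorem theorem11 (R : realType) (n m : nat)
  (f : 'rV[R]_n -> \bar R) (g : 'rV[R]_m -> \bar R)
  (Q : 'rV[R]_(n + m) -> R) (L : 'rV[R]_(n + m) -> \bar R)
  (f_proper : proper_efun f) (f_lsc : lower_semicontinuous f)
  (g_proper : proper_efun g) (g_lsc : lower_semicontinuous g)
  (Q_C1 : C1 Q) (Q_lip : lipschitz_on_bounded_sets (gradient Q))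
  (L_def : forall (u : 'rV[R]_n) (v : 'rV[R]_m),
     L (row_mx u v) = (f u + (Q (row_mx u v))%:E + g v)%E)
  (x : nat -> 'rV[R]_n) (y : nat -> 'rV[R]_m)
  (L_inf : (-oo < ereal_inf (range L))%E)
  (L_proper : proper_efun (fun u : 'rV[R]_n => L (row_mx u (y 0%N))))
  (rm rp : R) (lambda mu : nat -> R)
  (hr : 0 < rm < rp)
  (hlambda : forall k, rm < lambda k < rp)
  (hmu : forall k, rm < mu k < rp)
  (hx : forall k, argmin (fun u : 'rV[R]_n =>
     (L (row_mx u (y k)) + ((2 * lambda k)^-1 * enorm (u - x k) ^+ 2)%:E)%E)
     (x k.+1))
  (hy : forall k, argmin (fun v : 'rV[R]_m =>
     (L (row_mx (x k.+1) v) + ((2 * mu k)^-1 * enorm (v - y k) ^+ 2)%:E)%E)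
     (y k.+1))
  (xoo : 'rV[R]_n) (yoo : 'rV[R]_m)
  (hcvg : row_mx (x k) (y k) @[k --> \oo] --> row_mx xoo yoo)
  (theta a : R) (htheta : 0 <= theta < 1) (ha : 0 < a)
  (hKL : KL_property L (row_mx xoo yoo) (fun s : R => a * s `^ (1 - theta))) :
  [/\ theta = 0 ->
        exists K : nat, forall k, (K <= k)%N -> x k = xoo /\ y k = yoo,
      0 < theta <= 2^-1 ->
        exists c tau : R, [/\ 0 < c, 0 <= tau < 1 &
          forall k : nat,
            enorm (row_mx (x k) (y k) - row_mx xoo yoo) <= c * tau ^+ k] &
      2^-1 < theta < 1 ->
        exists2 c : R, 0 < c &
          forall k : nat, (1 <= k)%N ->
            enorm (row_mx (x k) (y k) - row_mx xoo yoo)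
              <= c * k%:R `^ (- ((1 - theta) / (2 * theta - 1)))].
Proof.
have /andP[th0 th1] := htheta.
have L_fin : L (row_mx xoo yoo) \is a fin_num.
  have [[p [Loo _]] _] := hKL; move: Loo; rewrite fin_numE -ltNye -ltey L_def.
  have := f_proper.1 xoo; have := g_proper.1 yoo.
  case: (f xoo) => [u||] //; case: (g yoo) => [v||] //= _ _ _.
  by rewrite ltNyr ltry.
have [K [alpha [B [r D]]]] := alternating_lojasiewicz_descent f_proper f_lsc
  g_proper g_lsc Q_C1 Q_lip L_def L_proper hr hlambda hmu hx hy hcvg L_fin th1
  ha hKL.
pose e k := enorm (row_mx (x k) (y k) - row_mx xoo yoo).
have e0 k : 0 <= e k by exact: enorm_ge0.
have idx k : (K < k)%N -> (K + (k - K.+1).+1)%N = k by lia.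
split.
- move=> t0; have [K' HK'] := descent_finite D t0.
  exists (K + K')%N => k Kk.
  have kK : (K' <= k - K)%N by lia.
  have Kk' : (K <= k)%N by lia.
  by have := HK' _ kK; rewrite subnKC// => /eq_row_mx.
- move=> /andP[t0 t2]; have t01 : 0 < theta < 1 by rewrite t0.
  have [c [tau [c0 /andP[tau0 tau1] H]]] := descent_linear D t01 t2.
  have bp k : 0 < tau ^+ k by rewrite exprn_gt0.
  have tail k : (K < k)%N -> e k <= c / tau ^+ K.+1 * tau ^+ k.
    move=> Kk; have := H (k - K.+1)%N; rewrite idx// => /le_trans; apply.
    rewrite -mulrA ler_pM2l// mulrC -[X in _ <= tau ^+ X / _](subnK Kk).
    by rewrite exprD mulfK// gt_eqF.
  have [c' c'0 Hc'] :=
    eventual_bound (k0 := 0) e0 (fun k => ltW (bp k)) (fun k _ => bp k) tail.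
  by exists c', tau; split => //; [rewrite (ltW tau0)|move=> k; exact: Hc'].
move=> /andP[t2 _]; have t01 : 0 < theta < 1 by apply/andP; split; lra.
set beta : R := (1 - theta) / _.
have b0 : 0 < beta by apply: divr_gt0; lra.
have [c c0 H] := descent_sublinear D t01 t2.
pose b k : R := k%:R `^ (- beta).
have bp k : (0 < k)%N -> 0 < b k by move=> k0; rewrite powR_gt0// ltr0n.
(* beyond rank [2 * K.+1], the shifted index [k - K.+1] is at least [k / 2] *)
have tail k : (2 * K.+1 < k)%N -> e k <= c * 2^-1 `^ (- beta) * b k.
  move=> Kk; have Kk' : (K < k)%N by lia.
  have kK : (0 < k - K.+1)%N by lia.
  have := H _ kK; rewrite idx// -/beta => /le_trans; apply.
  rewrite -mulrA ler_pM2l// -powRM ?invr_ge0// !powRN.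
  have k2 : 2^-1 * k%:R <= (k - K.+1)%:R :> R.
    rewrite natrB//; have : (2 * K.+1)%:R < k%:R :> R by rewrite ltr_nat.
    by rewrite natrM; lra.
  have k0 : 0 < 2^-1 * k%:R :> R by rewrite mulr_gt0 ?invr_gt0// ltr0n; lia.
  rewrite lef_pV2 ?posrE ?powR_gt0// ?ltr0n//.
  by apply: ge0_ler_powR; rewrite ?nnegrE ?(ltW b0) ?(ltW k0).
have [c' c'0 Hc'] := eventual_bound e0 (fun k => powR_ge0 _ _) bp tail.
by exists c'.
Qed.
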